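(* Let $\omega_7=\frac{1}{2}(1+i\sqrt{7})$, let $\Gamma_7=PU(2,1;\mathcal{O}_7)$ with $\mathcal{O}_7=\mathbb{Z}[\omega_7]$, and let $(\Gamma_7)_\infty$ be the stabiliser of $q_\infty$ in $\Gamma_7$. Then $(\Gamma_7)_\infty$ is generated by $$R_1=\begin{bmatrix}1&0&0\\0&-1&0\\0&0&1\end{bmatrix},\quad R_2=\begin{bmatrix}1&1&-\bar{\omega}_7\\0&-1&1\\0&0&1\end{bmatrix},\quad R_3=\begin{bmatrix}1&\bar{\omega}_7&-1\\0&-1&\omega_7\\0&0&1\end{bmatrix}\quad\text{and}\quad T=\begin{bmatrix}1&0&i\sqrt{7}\\0&1&0\\0&0&1\end{bmatrix}.$$ A presentation is given by $$(\Gamma_7)_\infty=\langle R_1,R_2,R_3,T\mid R_1^2=R_3^2=[T,R_1]=[T,R_3]=TR_2^{-2}=(R_1R_3R_2)^2=\mathrm{id}\rangle.$$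
   Context: $\mathbb{C}^{2,1}$ is $\mathbb{C}^3$ with the Hermitian form $\langle \mathbf{z},\mathbf{w}\rangle=z_1\bar{w}_3+z_2\bar{w}_2+z_3\bar{w}_1$. $U(2,1)$ is the group of $3\times 3$ complex matrices preserving this form, and $PU(2,1)=U(2,1)/U(1)$, where $U(1)=\{e^{i\theta}I\}$. $PU(2,1;\mathcal{O})$ denotes the subgroup of $PU(2,1)$ consisting of classes of matrices in $U(2,1)$ with all entries in the ring $\mathcal{O}$; matrices stand for their classes. $q_\infty$ is the point of the complex projective plane represented by the column vector $[1,0,0]^t$. $[a,b]$ denotes the commutator $aba^{-1}b^{-1}$. *)

(* Defs.v *)
From HB Require Import structures.
From mathcomp Require Import all_boot all_order all_algebra.
From mathcomp Require Import generic_quotient boolp reals trigo.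
From mathcomp Require Import complex ring.

Set Implicit Arguments.
Unset Strict Implicit.
Unset Printing Implicit Defensive.

Import Order.TTheory GRing.Theory Num.Theory.

Local Open Scope quotient_scope.
Local Open Scope group_scope.

Record normalSubgroup (G : groupType) := NormalSubgroup {
  nsub_pred :> {pred G};
  nsub_closed : group_closed nsub_pred;
  nsub_conj : forall x y, x \in nsub_pred -> x ^ y \in nsub_pred }.

Section QuotientGroup.
Variables (G : groupType) (N : normalSubgroup G).

Lemma nsub1 : 1 \in N. Proof. by case: (nsub_closed N). Qed.
Lemma nsubM x y : x \in N -> y \in N -> x * y \in N.
Proof. exact: group_closedM (nsub_closed N) x y. Qed.
Lemma nsubV x : x \in N -> x^-1 \in N.
Proof. exact: group_closedV (nsub_closed N) x. Qed.

Definition coset_rel : rel G := fun x y => x^-1 * y \in N.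

Lemma coset_rel_refl : reflexive coset_rel.
Proof. by move=> x; rewrite /coset_rel mulVg nsub1. Qed.
Lemma coset_rel_sym : symmetric coset_rel.
Proof.
by move=> x y; apply/idP/idP => /nsubV; rewrite /coset_rel invgM invgK.
Qed.
Lemma coset_rel_trans : transitive coset_rel.
Proof.
by move=> y x z xy yz; have := nsubM xy yz; rewrite -mulgA mulVKg.
Qed.

Canonical coset_equiv :=
  EquivRel coset_rel coset_rel_refl coset_rel_sym coset_rel_trans.

Definition quotg := {eq_quot coset_rel}.
HB.instance Definition _ := Choice.on quotg.

Definition quotg_proj (x : G) : quotg := \pi_quotg x.
Definition quotg_repr (a : quotg) : G := repr a.

Definition quotg_one : quotg := quotg_proj 1.
Definition quotg_mul (a b : quotg) : quotg :=
  quotg_proj (quotg_repr a * quotg_repr b).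
Definition quotg_inv (a : quotg) : quotg := quotg_proj (quotg_repr a)^-1.

Lemma quotg_reprK : cancel quotg_repr quotg_proj.
Proof. exact: reprK. Qed.
Lemma quotgW (P : quotg -> Prop) : (forall x, P (quotg_proj x)) -> forall a, P a.
Proof. by move=> Pp a; rewrite -[a]quotg_reprK. Qed.

Lemma quotg_eqP (x y : G) :
  reflect (quotg_proj x = quotg_proj y) (x^-1 * y \in N).
Proof. exact: (@eqmodP _ _ x y). Qed.

Lemma repr_quotg (x : G) : x^-1 * quotg_repr (quotg_proj x) \in N.
Proof. by apply/quotg_eqP; rewrite quotg_reprK. Qed.

Lemma quotg_mulE (x y : G) :
  quotg_mul (quotg_proj x) (quotg_proj y) = quotg_proj (x * y).
Proof.
apply/esym/quotg_eqP; set x' := quotg_repr _; set y' := quotg_repr _.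
have -> : (x * y)^-1 * (x' * y') = (x^-1 * x') ^ y * (y^-1 * y').
  by rewrite conjgE invgM !mulgA mulgK.
by apply: nsubM; [apply: nsub_conj|]; apply: repr_quotg.
Qed.

Lemma quotg_invE (x : G) : quotg_inv (quotg_proj x) = quotg_proj x^-1.
Proof.
apply/quotg_eqP; rewrite invgK; set x' := quotg_repr _.
have -> : x' * x^-1 = (x^-1 * x') ^ x^-1.
  by rewrite conjgE invgK !mulgA mulgV mul1g.
exact/nsub_conj/repr_quotg.
Qed.

Lemma quotg_mulA : associative quotg_mul.
Proof.
elim/quotgW=> x; elim/quotgW=> y; elim/quotgW=> z.
by rewrite !quotg_mulE mulgA.
Qed.
Lemma quotg_mul1 : left_id quotg_one quotg_mul.
Proof. by elim/quotgW=> x; rewrite quotg_mulE mul1g. Qed.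
Lemma quotg_1mul : right_id quotg_one quotg_mul.
Proof. by elim/quotgW=> x; rewrite quotg_mulE mulg1. Qed.
Lemma quotg_mulV : left_inverse quotg_one quotg_inv quotg_mul.
Proof. by elim/quotgW=> x; rewrite quotg_invE quotg_mulE mulVg. Qed.
Lemma quotg_Vmul : right_inverse quotg_one quotg_inv quotg_mul.
Proof. by elim/quotgW=> x; rewrite quotg_invE quotg_mulE mulgV. Qed.

HB.instance Definition _ := isGroup.Build quotg
  quotg_mulA quotg_mul1 quotg_1mul quotg_mulV quotg_Vmul.

Lemma quotg_projM : {morph quotg_proj : x y / x * y}.
Proof. by move=> x y; rewrite [RHS]quotg_mulE. Qed.

End QuotientGroup.

(* Free groups: a letter (i, true) is the generator x_i and (i, false) its    *)
(* inverse; words are identified up to insertion and deletion of x x^-1.      *)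

Section FreeGroup.
Variable I : choiceType.

Definition word := seq (I * bool).

Inductive free_eq : word -> word -> Prop :=
| FreeCancel u i b v : free_eq (u ++ (i, b) :: (i, ~~ b) :: v) (u ++ v)
| FreeRefl u : free_eq u u
| FreeSym u v : free_eq u v -> free_eq v u
| FreeTrans v u w : free_eq u v -> free_eq v w -> free_eq u w.

Definition free_rel : rel word := fun u v => `[< free_eq u v >].

Lemma free_rel_refl : reflexive free_rel.
Proof. by move=> u; apply/asboolP/FreeRefl. Qed.
Lemma free_rel_sym : symmetric free_rel.
Proof. by move=> u v; apply/asboolP/asboolP => /FreeSym. Qed.
Lemma free_rel_trans : transitive free_rel.
Proof. by move=> v u w /asboolP uv /asboolP/(FreeTrans uv)/asboolP. Qed.

Canonical free_equiv :=
  EquivRel free_rel free_rel_refl free_rel_sym free_rel_trans.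

Definition free_group := {eq_quot free_rel}.
HB.instance Definition _ := Choice.on free_group.

Definition word_inv (u : word) : word := rev [seq (l.1, ~~ l.2) | l <- u].

Lemma word_inv_cons l u : word_inv (l :: u) = word_inv u ++ [:: (l.1, ~~ l.2)].
Proof. by rewrite /word_inv /= rev_cons cats1. Qed.
Lemma word_inv_cat u v : word_inv (u ++ v) = word_inv v ++ word_inv u.
Proof. by rewrite /word_inv map_cat rev_cat. Qed.

Lemma free_eq_cat2l w u v : free_eq u v -> free_eq (w ++ u) (w ++ v).
Proof.
elim=> {u v} [u i b v|u|u v _ IH|v u z _ IH1 _ IH2].
- by rewrite !catA; apply: FreeCancel.
- exact: FreeRefl.
- exact: FreeSym.
- exact: FreeTrans IH2.
Qed.

Lemma free_eq_cat2r w u v : free_eq u v -> free_eq (u ++ w) (v ++ w).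
Proof.
elim=> {u v} [u i b v|u|u v _ IH|v u z _ IH1 _ IH2].
- by rewrite -!catA; apply: FreeCancel.
- exact: FreeRefl.
- exact: FreeSym.
- exact: FreeTrans IH2.
Qed.

Lemma free_eq_cat u u' v v' :
  free_eq u u' -> free_eq v v' -> free_eq (u ++ v) (u' ++ v').
Proof.
by move=> uu' vv'; apply: FreeTrans (free_eq_cat2r v uu') (free_eq_cat2l u' vv').
Qed.

Lemma free_eq_inv u v : free_eq u v -> free_eq (word_inv u) (word_inv v).
Proof.
elim=> {u v} [u i b v|u|u v _ IH|v u z _ IH1 _ IH2].
- rewrite !word_inv_cat !word_inv_cons /= -!catA /= negbK.
  exact: FreeCancel.
- exact: FreeRefl.
- exact: FreeSym.
- exact: FreeTrans IH2.
Qed.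

Lemma free_eq_Vw u : free_eq (word_inv u ++ u) [::].
Proof.
elim: u => [|[i b] u IH]; first exact: FreeRefl.
rewrite word_inv_cons -catA /=; apply: FreeTrans IH.
by have := FreeCancel (word_inv u) i (~~ b) u; rewrite negbK.
Qed.

Lemma word_invK : involutive word_inv.
Proof.
move=> u; rewrite /word_inv map_rev revK -map_comp.
by rewrite -[RHS]map_id; apply: eq_map => -[i b] /=; rewrite negbK.
Qed.

Lemma free_eq_wV u : free_eq (u ++ word_inv u) [::].
Proof. by rewrite -{1}[u]word_invK; apply: free_eq_Vw. Qed.

Definition free_class (u : word) : free_group := \pi_free_group u.
Definition free_repr (a : free_group) : word := repr a.

Lemma free_reprK : cancel free_repr free_class.
Proof. exact: reprK. Qed.
Lemma freeW (P : free_group -> Prop) : (forall u, P (free_class u)) -> forall a, P a.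
Proof. by move=> Pp a; rewrite -[a]free_reprK. Qed.

Lemma free_eqP (u v : word) :
  reflect (free_class u = free_class v) `[< free_eq u v >].
Proof. exact: (@eqmodP _ _ u v). Qed.

Lemma free_eq_pi u v : free_eq u v -> free_class u = free_class v.
Proof. by move=> uv; apply/free_eqP/asboolP. Qed.

Lemma repr_free (u : word) : free_eq u (free_repr (free_class u)).
Proof. by apply/asboolP/free_eqP; rewrite free_reprK. Qed.

Definition free_one : free_group := free_class [::].
Definition free_mul (a b : free_group) : free_group := free_class (free_repr a ++ free_repr b).
Definition free_inv (a : free_group) : free_group := free_class (word_inv (free_repr a)).

Lemma free_mulE (u v : word) :
  free_mul (free_class u) (free_class v) = free_class (u ++ v).
Proof. by apply/esym/free_eq_pi/free_eq_cat; apply: repr_free. Qed.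
Lemma free_invE (u : word) :
  free_inv (free_class u) = free_class (word_inv u).
Proof. by apply/esym/free_eq_pi/free_eq_inv/repr_free. Qed.

Lemma free_mulA : associative free_mul.
Proof.
by elim/freeW=> u; elim/freeW=> v; elim/freeW=> w; rewrite !free_mulE catA.
Qed.
Lemma free_mul1 : left_id free_one free_mul.
Proof. by elim/freeW=> u; rewrite free_mulE. Qed.
Lemma free_1mul : right_id free_one free_mul.
Proof. by elim/freeW=> u; rewrite free_mulE cats0. Qed.
Lemma free_mulV : left_inverse free_one free_inv free_mul.
Proof.
by elim/freeW=> u; rewrite free_invE free_mulE; apply/free_eq_pi/free_eq_Vw.
Qed.
Lemma free_Vmul : right_inverse free_one free_inv free_mul.
Proof.
by elim/freeW=> u; rewrite free_invE free_mulE; apply/free_eq_pi/free_eq_wV.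
Qed.

HB.instance Definition _ := isGroup.Build free_group
  free_mulA free_mul1 free_1mul free_mulV free_Vmul.

Definition free_gen (i : I) : free_group := free_class [:: (i, true)].

End FreeGroup.

Section Presentations.

Definition normal_closure_pred (G : groupType) (S : {pred G}) : {pred G} :=
  fun x => `[< forall N : normalSubgroup G, {subset S <= N} -> x \in N >].

Lemma normal_closure_closed (G : groupType) (S : {pred G}) :
  group_closed (normal_closure_pred S).
Proof.
split=> [|x y /asboolP xS /asboolP yS]; apply/asboolP => N SN.
  exact: nsub1.
by apply: nsubM; [apply: xS|apply/nsubV/yS].
Qed.

Lemma normal_closure_conj (G : groupType) (S : {pred G}) x y :
  x \in normal_closure_pred S -> x ^ y \in normal_closure_pred S.
Proof. by move=> /asboolP xS; apply/asboolP => N SN; apply/nsub_conj/xS. Qed.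

Definition normal_closure (G : groupType) (S : {pred G}) : normalSubgroup G :=
  NormalSubgroup (@normal_closure_closed G S) (@normal_closure_conj G S).

Definition presented_group (I : choiceType) (rels : seq (free_group I)) :=
  quotg (normal_closure [pred r in rels]).

Definition presented_gen (I : choiceType) (rels : seq (free_group I)) (i : I) :
  presented_group rels := quotg_proj _ (free_gen i).

Definition has_presentation (G : groupType) (I : choiceType) (g : I -> G)
    (rels : seq (free_group I)) : Prop :=
  exists phi : presented_group rels -> G,
    [/\ {morph phi : x y / x * y}, bijective phi
      & forall i, phi (presented_gen rels i) = g i].

Definition generates (G : groupType) (I : Type) (g : I -> G) : Prop :=
  forall H : {pred G}, group_closed H -> (forall i, g i \in H) ->
  forall x, x \in H.

(* The convention a b a^-1 b^-1; MathComp's [~ a, b] is a^-1 b^-1 a b.        *)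
Definition commutator (G : groupType) (a b : G) : G := a * b * a^-1 * b^-1.

End Presentations.

Local Close Scope group_scope.
Local Open Scope ring_scope.

Section UnitCircle.
Variable R : realType.

Lemma normC1_expi (c : R[i]) :
  `|c| = 1 <-> exists t : R, c = (cos t +i* sin t)%C.
Proof.
split=> [|[t ->]]; last first.
  by rewrite normc_def /= addrC sin2cos2 subrK sqrtr1.
case: c => a b; rewrite normc_def /= => -[] ab1.
have {}ab1 : a ^+ 2 + b ^+ 2 = 1.
  by rewrite -[LHS]sqr_sqrtr ?addr_ge0 ?sqr_ge0 // ab1 expr1n.
have a1 : -1 <= a <= 1.
  by rewrite -ler_norml -(@expr_le1 _ 2) // real_normK ?num_real // -ab1 lerDl sqr_ge0.
have sa : sin (acos a) = `|b|.
  by rewrite sin_acos // -ab1 addrC addKr sqrtr_sqr.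
have [b0|b0] := leP 0 b.
  by exists (acos a); rewrite acosK // sa ger0_norm.
by exists (- acos a); rewrite cosN sinN acosK // sa ltr0_norm // opprK.
Qed.

End UnitCircle.

Section UnitaryGroup.
Variable C : numClosedFieldType.

Definition herm21 (z w : 'cV[C]_3) : C :=
  z 0 0 * (w 2 0)^* + z 1 0 * (w 1 0)^* + z 2 0 * (w 0 0)^*.

Definition preserves_herm21 : pred 'M[C]_3 := fun A =>
  `[< forall z w, herm21 (A *m z) (A *m w) = herm21 z w >].

Record U21 := MkU21 { U21_mx :> 'M[C]_3; _ : preserves_herm21 U21_mx }.
HB.instance Definition _ := [isSub for U21_mx].
HB.instance Definition _ := [Choice of U21 by <:].

Lemma U21P (A : U21) z w : herm21 (A *m z) (A *m w) = herm21 z w.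
Proof. by case: A => A /= /asboolP. Qed.

Lemma herm21_nondeg z : (forall w, herm21 z w = 0) -> z = 0.
Proof.
move=> zw; apply/matrixP => i j; rewrite ord1 mxE.
have z0 := zw (delta_mx 2 0); have z1 := zw (delta_mx 1 0).
have z2 := zw (delta_mx 0 0).
rewrite /herm21 !mxE /= !rmorph0 !rmorph1 !mulr0 ?add0r ?addr0 !mulr1 in z0 z1 z2.
case: i => -[|[|[|]]] //= h.
- by rewrite -[RHS]z0; congr (z _ _); apply: val_inj.
- by rewrite -[RHS]z1; congr (z _ _); apply: val_inj.
- by rewrite -[RHS]z2; congr (z _ _); apply: val_inj.
Qed.

Lemma U21_unit (A : U21) : (A : 'M_3) \in unitmx.
Proof.
rewrite -unitmx_tr -row_free_unit; apply: inj_row_free => v vA.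
apply: trmx_inj; rewrite trmx0; apply: herm21_nondeg => w.
rewrite -(U21P A) -[X in X *m _]trmxK -trmx_mul vA trmx0.
by rewrite /herm21 !mxE !mul0r !addr0.
Qed.

Lemma U21_one_subproof : preserves_herm21 1%:M.
Proof. by apply/asboolP => z w; rewrite !mul1mx. Qed.
Lemma U21_mul_subproof (A B : U21) : preserves_herm21 (A *m B).
Proof. by apply/asboolP => z w; rewrite -!mulmxA !U21P. Qed.
Lemma U21_inv_subproof (A : U21) : preserves_herm21 (invmx A).
Proof.
by apply/asboolP => z w; rewrite -(U21P A) !mulKVmx ?U21_unit.
Qed.

Definition U21_one := MkU21 U21_one_subproof.
Definition U21_mul A B := MkU21 (U21_mul_subproof A B).
Definition U21_inv A := MkU21 (U21_inv_subproof A).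

Lemma U21_mulA : associative U21_mul.
Proof. by move=> A B D; apply: val_inj; apply: mulmxA. Qed.
Lemma U21_mul1 : left_id U21_one U21_mul.
Proof. by move=> A; apply: val_inj; apply: mul1mx. Qed.
Lemma U21_1mul : right_id U21_one U21_mul.
Proof. by move=> A; apply: val_inj; apply: mulmx1. Qed.
Lemma U21_mulV : left_inverse U21_one U21_inv U21_mul.
Proof. by move=> A; apply: val_inj; apply/mulVmx/U21_unit. Qed.
Lemma U21_Vmul : right_inverse U21_one U21_inv U21_mul.
Proof. by move=> A; apply: val_inj; apply/mulmxV/U21_unit. Qed.

HB.instance Definition _ := isGroup.Build U21
  U21_mulA U21_mul1 U21_1mul U21_mulV U21_Vmul.

(* U(1) is the group of scalar matrices c I with |c| = 1; see normC1_expi.     *)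
Definition U1_pred : {pred U21} := fun A =>
  `[< exists2 c : C, `|c| = 1 & (A : 'M_3) = c%:M >].

Lemma U1_closed : group_closed U1_pred.
Proof.
split=> [|A B /asboolP[c c1 Ac] /asboolP[d d1 Bd]]; apply/asboolP.
  by exists 1; rewrite ?normr1.
have d0 : d != 0 by rewrite -normr_eq0 d1 oner_eq0.
exists (c / d); first by rewrite normrM normfV c1 d1 invr1 mulr1.
rewrite /= Ac; apply: (can_inj (mulmxK (U21_unit B))).
by rewrite mulmxKV ?U21_unit // Bd -scalar_mxM divfK.
Qed.

Lemma U1_conj A B : A \in U1_pred -> (A ^ B)%g \in U1_pred.
Proof.
move=> /asboolP[c c1 Ac]; apply/asboolP; exists c => //.
by rewrite /= Ac mul_scalar_mx -scalemxAr mulVmx ?U21_unit // scalemx1.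
Qed.

Definition U1 : normalSubgroup U21 := NormalSubgroup U1_closed U1_conj.

Definition PU21 := quotg U1.
Definition to_PU21 (A : U21) : PU21 := quotg_proj U1 A.

Lemma to_PU21M : {morph to_PU21 : A B / (A * B)%g}.
Proof. exact: quotg_projM. Qed.
Lemma to_PU21V : {morph to_PU21 : A / A^-1%g}.
Proof. by move=> A; rewrite [RHS]quotg_invE. Qed.
Lemma to_PU21_surj g : exists A, to_PU21 A = g.
Proof. by exists (quotg_repr g); apply: quotg_reprK. Qed.
Lemma to_PU21_eq A B : to_PU21 A = to_PU21 B -> exists2 c : C,
  c != 0 & (A : 'M_3) = c *: (B : 'M_3).
Proof.
move=> /quotg_eqP/(nsubV (N := U1)); rewrite invgM invgK => /asboolP[c c1 /= E].
exists c; first by rewrite -normr_eq0 c1 oner_eq0.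
have {1}-> : (A : 'M_3) = (B : 'M_3) *m (invmx B *m A).
  by rewrite mulKVmx ?U21_unit.
by rewrite E mul_mx_scalar.
Qed.

(* Nonzero vectors represent the same point of the projective plane.          *)
Definition same_point (z w : 'cV[C]_3) : Prop :=
  exists2 c : C, c != 0 & z = c *: w.

Definition PU21_stab (z : 'cV[C]_3) : {pred PU21} := fun g =>
  `[< forall A : U21, to_PU21 A = g -> same_point (A *m z) z >].

Lemma PU21_stabP z (A : U21) :
  reflect (same_point (A *m z) z) (to_PU21 A \in PU21_stab z).
Proof.
apply: (iffP (asboolP _)) => [|[c c0 Az] B /to_PU21_eq[d d0 ->]]; first exact.
by exists (d * c); rewrite ?mulf_neq0 // -scalemxAl Az scalerA.
Qed.

Lemma PU21_stab_closed z : group_closed (PU21_stab z).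
Proof.
split=> [|g h]; first by apply/(PU21_stabP z 1%g); exists 1;
  rewrite ?oner_eq0 // mul1mx scale1r.
have [A <-] := to_PU21_surj g; have [B <-] := to_PU21_surj h.
move=> /PU21_stabP[c c0 Az] /PU21_stabP[d d0 Bz].
rewrite -to_PU21V -to_PU21M; apply/PU21_stabP.
exists (c / d); first by rewrite mulf_neq0 ?invr_eq0.
rewrite /= -mulmxA; have -> : invmx B *m z = d^-1 *: z.
  apply: (can_inj (mulKmx (U21_unit B))).
  by rewrite mulKVmx ?U21_unit // -scalemxAr Bz scalerA mulVf ?scale1r.
by rewrite -scalemxAr Az scalerA mulrC.
Qed.

Definition PU21_over (O : {pred C}) : {pred PU21} := fun g =>
  `[< exists2 A : U21, to_PU21 A = g & forall i j, A i j \in O >].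

Lemma U21_inv_entry (A : U21) i j :
  (A^-1)%g i j = (A (rev_ord j) (rev_ord i))^*.
Proof.
have key (z w : 'cV_3) : herm21 (invmx A *m z) w = herm21 z (A *m w).
  by rewrite -(U21P A) mulKVmx ?U21_unit.
have hl (z : 'cV[C]_3) k : herm21 z (delta_mx (rev_ord k) 0) = z k 0.
  rewrite /herm21 !mxE; case: k => -[|[|[|]]] //= h;
  rewrite !rmorph0 !rmorph1 !mulr0 ?add0r ?addr0 !mulr1;
  by congr (z _ _); apply: val_inj.
have hr (z : 'cV[C]_3) k : herm21 (delta_mx k 0) z = (z (rev_ord k) 0)^*.
  rewrite /herm21 !mxE; case: k => -[|[|[|]]] //= h;
  rewrite !mul0r ?add0r ?addr0 !mul1r;
  by congr ((z _ _)^*); apply: val_inj.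
have := key (delta_mx j 0) (delta_mx (rev_ord i) 0).
by rewrite hl hr -!colE !mxE.
Qed.

Lemma PU21_over_closed (O : {pred C}) :
  subring_closed O -> {in O, forall x, x^* \in O} -> group_closed (PU21_over O).
Proof.
move=> O_ring O_conj; have [O1 _ OM] := O_ring.
have [[O0 OD] _] := GRing.subring_closed_semi O_ring.
split=> [|_ _ /asboolP[A <- AO] /asboolP[B <- BO]]; apply/asboolP.
  by exists 1%g => // i j; rewrite /= mxE; case: (i == j) => /=; rewrite ?mulr1n ?mulr0n.
exists (A * B^-1)%g; first by rewrite to_PU21M to_PU21V.
move=> i j; rewrite /= mxE.
elim/big_ind: _ => [|x y|k _]; [exact: O0|exact: OD|].
by apply: OM (AO _ _) _; rewrite [invmx _ _ _]U21_inv_entry; apply: O_conj.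
Qed.

End UnitaryGroup.

Section Gamma7.
Variable C : numClosedFieldType.

Definition i_sqrt7 : C := 'i * sqrtC 7.
Definition omega7 : C := 2^-1 * (1 + i_sqrt7).

(* Z[omega7] as the image of Z[X] under evaluation at omega7.                 *)
Definition O7 : {pred C} := fun x =>
  `[< exists p : {poly int}, x = (map_poly intr p).[omega7] >].

Lemma i_sqrt7_sq : i_sqrt7 ^+ 2 = - 7.
Proof. by rewrite exprMn sqrCi sqrtCK mulN1r. Qed.
Lemma conj_i_sqrt7 : i_sqrt7^* = - i_sqrt7.
Proof.
rewrite rmorphM /= conjCi mulNr; congr (- (_ * _)).
by apply: conj_Creal; rewrite ger0_real // sqrtC_ge0 ler0n.
Qed.
Lemma conj_omega7 : omega7^* = 1 - omega7.
Proof.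
rewrite /omega7 rmorphM rmorphD /= conj_i_sqrt7 fmorphV rmorph1 rmorph_nat.
by field.
Qed.
Lemma omega7_sq : omega7 ^+ 2 = omega7 - 2.
Proof.
rewrite /omega7 exprMn sqrrD i_sqrt7_sq.
by field.
Qed.

Lemma O7_closed : subring_closed O7.
Proof.
split.
- by apply/asboolP; exists 1; rewrite rmorph1 hornerC.
- move=> _ _ /asboolP[p ->] /asboolP[q ->]; apply/asboolP; exists (p - q).
  by rewrite rmorphB hornerD hornerN.
- move=> _ _ /asboolP[p ->] /asboolP[q ->]; apply/asboolP; exists (p * q).
  by rewrite rmorphM hornerM.
Qed.

Lemma O7_conj : {in O7, forall x, x^* \in O7}.
Proof.
move=> _ /asboolP[p ->]; apply/asboolP; exists (p \Po (1 - 'X)).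
rewrite map_comp_poly horner_comp rmorphB rmorph1 /= map_polyX !hornerE.
rewrite -conj_omega7 -horner_map -map_poly_comp; congr (_.[_]).
by apply: eq_map_poly => n /=; rewrite rmorph_int.
Qed.

Lemma O7_omega7 : omega7 \in O7.
Proof. by apply/asboolP; exists 'X; rewrite map_polyX hornerX. Qed.

Definition Gamma7 : {pred PU21 C} := PU21_over O7.

Definition q_infty : 'cV[C]_3 := \col_i [:: 1; 0; 0]`_i.

Definition Gamma7_inf_pred : pred (PU21 C) := fun g =>
  (g \in Gamma7) && (g \in PU21_stab q_infty).

Lemma Gamma7_inf_closed : group_closed Gamma7_inf_pred.
Proof.
have [G1 GF] : group_closed Gamma7 := PU21_over_closed O7_closed O7_conj.
have [S1 SF] := PU21_stab_closed q_infty.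
split=> [|g h /andP[gG gS] /andP[hG hS]]; apply/andP; split => //.
- exact: GF.
- exact: SF.
Qed.

Record Gamma7_inf := MkGamma7_inf {
  Gamma7_inf_val :> PU21 C; _ : Gamma7_inf_pred Gamma7_inf_val }.
HB.instance Definition _ := [isSub for Gamma7_inf_val].
HB.instance Definition _ := [Choice of Gamma7_inf by <:].
HB.instance Definition _ :=
  SubChoice_isSubGroup.Build _ _ Gamma7_inf Gamma7_inf_closed.

Definition mx3 (rows : seq (seq C)) : 'M[C]_3 :=
  \matrix_(i, j) (nth [::] rows i)`_j.

Definition R1_mx := mx3 [:: [:: 1;  0; 0];
                            [:: 0; -1; 0];
                            [:: 0;  0; 1]].
Definition R2_mx := mx3 [:: [:: 1;  1; - omega7^*];
                            [:: 0; -1; 1];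
                            [:: 0;  0; 1]].
Definition R3_mx := mx3 [:: [:: 1; omega7^*; -1];
                            [:: 0; -1; omega7];
                            [:: 0;  0; 1]].
Definition T_mx := mx3 [:: [:: 1; 0; i_sqrt7];
                           [:: 0; 1; 0];
                           [:: 0; 0; 1]].

Lemma mx3_mulE rows (z : 'cV[C]_3) k : (mx3 rows *m z) k 0 =
  (nth [::] rows k)`_0 * z 0 0 + (nth [::] rows k)`_1 * z 1 0
    + (nth [::] rows k)`_2 * z 2 0.
Proof.
rewrite mxE !big_ord_recl big_ord0 addr0 !mxE addrA.
by congr (_ + _ * z _ _ + _ * z _ _); apply: val_inj.
Qed.


Lemma mx3_herm21 rows (a := fun i j => (nth [::] rows i)`_j)
    (u := fun i (z0 z1 z2 : C) => a i 0%N * z0 + a i 1%N * z1 + a i 2%N * z2)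
    (v := fun i (w0 w1 w2 : C) =>
      (a i 0%N)^* * w0 + (a i 1%N)^* * w1 + (a i 2%N)^* * w2) :
  (forall z0 z1 z2 w0 w1 w2,
    u 0%N z0 z1 z2 * v 2%N w0 w1 w2 + u 1%N z0 z1 z2 * v 1%N w0 w1 w2
      + u 2%N z0 z1 z2 * v 0%N w0 w1 w2 = z0 * w2 + z1 * w1 + z2 * w0) ->
  preserves_herm21 (mx3 rows).
Proof.
move=> auv; apply/asboolP => z w; rewrite /herm21 !mx3_mulE.
by rewrite !(rmorphD, rmorphM); apply: auv.
Qed.

Lemma R1_herm21 : preserves_herm21 R1_mx.
Proof.
apply: mx3_herm21 => z0 z1 z2 w0 w1 w2 /=.
rewrite ?(rmorphN, rmorph0, rmorph1) /= ?conjCK ?conj_i_sqrt7 ?conj_omega7.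
by ring.
Qed.
Lemma R2_herm21 : preserves_herm21 R2_mx.
Proof.
apply: mx3_herm21 => z0 z1 z2 w0 w1 w2 /=.
rewrite ?(rmorphN, rmorph0, rmorph1) /= ?conjCK ?conj_i_sqrt7 ?conj_omega7.
by ring.
Qed.
Lemma R3_herm21 : preserves_herm21 R3_mx.
Proof.
apply: mx3_herm21 => z0 z1 z2 w0 w1 w2 /=.
rewrite ?(rmorphN, rmorph0, rmorph1) /= ?conjCK ?conj_omega7.
by ring: omega7_sq.
Qed.
Lemma T_herm21 : preserves_herm21 T_mx.
Proof.
apply: mx3_herm21 => z0 z1 z2 w0 w1 w2 /=.
rewrite ?(rmorphN, rmorph0, rmorph1) /= ?conjCK ?conj_i_sqrt7 ?conj_omega7.
by ring.
Qed.

Lemma mx3_Gamma7_inf rows (h : preserves_herm21 (mx3 rows)) :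
  all (all (fun x => x \in O7)) rows -> [seq r`_0 | r <- rows] = [:: 1; 0; 0] ->
  Gamma7_inf_pred (to_PU21 (MkU21 h)).
Proof.
have [[O0 _] _] := GRing.subring_closed_semi O7_closed.
move=> rowsO rows0; apply/andP; split.
  apply/asboolP; exists (MkU21 h) => // i j; rewrite /= mxE.
  have [ri|ri] := ltnP i (size rows); last by rewrite (nth_default _ ri) nth_nil.
  have [cj|cj] := ltnP j (size (nth [::] rows i)); last by rewrite (nth_default _ cj).
  by have /allP/(_ _ (mem_nth 0 cj)) := allP rowsO _ (mem_nth [::] ri).
apply/PU21_stabP; exists 1; rewrite ?oner_eq0 // scale1r.
apply/matrixP => i j; rewrite ord1 /= mx3_mulE !mxE /= mulr1 !mulr0 !addr0 -rows0.
rewrite (nth_map [::]) //.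
by have := congr1 size rows0; rewrite size_map /= => ->.
Qed.

Lemma O7_rules : ((0 \in O7) * (1 \in O7) * (-1 \in O7) * (omega7 \in O7)
  * (omega7^* \in O7) * (- omega7^* \in O7) * (i_sqrt7 \in O7))%type.
Proof.
have O7_ring := O7_closed; have [O1 OB _] := O7_ring.
have [[O0 OD] _] := GRing.subring_closed_semi O7_ring.
have ON x : x \in O7 -> - x \in O7 by rewrite -sub0r; apply: OB.
have Ow := O7_omega7; have Ow' := O7_conj Ow.
have -> : i_sqrt7 = omega7 - omega7^*.
  by rewrite conj_omega7 /omega7; field.
by rewrite O0 O1 Ow Ow' OB // !ON.
Qed.

Lemma R1_inf : Gamma7_inf_pred (to_PU21 (MkU21 R1_herm21)).
Proof. by apply: mx3_Gamma7_inf; rewrite //= !O7_rules. Qed.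
Lemma R2_inf : Gamma7_inf_pred (to_PU21 (MkU21 R2_herm21)).
Proof. by apply: mx3_Gamma7_inf; rewrite //= !O7_rules. Qed.
Lemma R3_inf : Gamma7_inf_pred (to_PU21 (MkU21 R3_herm21)).
Proof. by apply: mx3_Gamma7_inf; rewrite //= !O7_rules. Qed.
Lemma T_inf : Gamma7_inf_pred (to_PU21 (MkU21 T_herm21)).
Proof. by apply: mx3_Gamma7_inf; rewrite //= !O7_rules. Qed.

Definition R1 := MkGamma7_inf R1_inf.
Definition R2 := MkGamma7_inf R2_inf.
Definition R3 := MkGamma7_inf R3_inf.
Definition T := MkGamma7_inf T_inf.

Definition Gamma7_inf_gens : 'I_4 -> Gamma7_inf := tnth [tuple R1; R2; R3; T].

End Gamma7.

Definition Gamma7_inf_relators : seq (free_group 'I_4) :=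
  let r1 := free_gen (0 : 'I_4) in
  let r2 := free_gen (1 : 'I_4) in
  let r3 := free_gen (2 : 'I_4) in
  let t := free_gen (3 : 'I_4) in
  [:: r1 ^+ 2; r3 ^+ 2; commutator t r1; commutator t r3;
      t * r2 ^- 2; (r1 * r3 * r2) ^+ 2]%g.

(* Main.v *)
From HB Require Import structures.
Require Import Defs.
From mathcomp Require Import all_boot all_order all_algebra.
From mathcomp Require Import boolp reals complex.
From mathcomp Require Import zify ring.

Import Order.TTheory GRing.Theory Num.Theory.

(** Write A = R2 R1 and B = R3 R1.  The proof rests on one normal form: every
    element is A^m B^n T^k R1^e with m, n, k integers and e a bit.

    On the side of the presentation, the relations say that T is central, that
    B A = T A B, and that the involution R1 conjugates A to A^-1 T and B to
    B^-1 ([cusp_heis_relations]): a discrete Heisenberg group generated by A, B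
    and T, extended by R1.  Hence left multiplication by a generator sends a
    normal form to a normal form, and every word is equal to one
    ([cusp_word_nform]).

    On the side of matrices, the first column of an element of U(2,1) fixing
    q_infty is a multiple of the first basis vector, which together with the
    Hermitian form makes the matrix upper triangular.  Its diagonal entries are
    units of O_7, so they are signs, and after multiplication by a sign the
    matrix is determined by its middle entry (a sign), by its entry d in row 1,
    column 2, and by its corner s, where s + s^* = - d d^* ([stab_heis_mx]).
    Here d = m + n w is arbitrary in O_7, and two corners over the same d
    differ by an integral multiple of i sqrt 7, that is, by a power of T.
    Computing the matrix of A^m B^n T^k R1^e ([nform_heis_mx]) shows that each
    such matrix is a normal form, and that a scalar normal form has trivial
    exponents.

    The generators satisfy the relations, so there is a morphism from the
    presented group to the stabiliser taking normal forms to normal forms with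
    the same exponents.  It is onto because every element of the stabiliser is
    a normal form, and its kernel is trivial because every element of the
    presented group is one as well ([cusp_presentation]). *)

(** * Integer powers in a group *)

Section IntegerPowers.
Local Open Scope group_scope.

Definition gexpz {G : groupType} (x : G) (n : int) : G :=
  match n with Posz k => x ^+ k | Negz k => x ^- k.+1 end.

Lemma gexpzS {G : groupType} (x : G) (n : int) :
  gexpz x (n + 1)%R = x * gexpz x n.
Proof.
case: n => [n|[|n]].
- have -> : (Posz n + 1)%R = Posz n.+1 by lia.
  exact: expgS.
- by rewrite /= expg1 mulgV.
- have -> : (Negz n.+1 + 1)%R = Negz n by lia.
  by rewrite /= [x ^+ n.+2]expgSr invgM mulVKg.
Qed.

(** The laws of exponents below follow from this without sign analysis: two
    functions of an integer agree as soon as they start at the same point and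
    obey the same one-step recursion. *)
Lemma gexpz_unique {G : groupType} {x y : G} {f : int -> G} :
  f 0%R = y -> (forall n, f (n + 1)%R = x * f n) ->
  forall n, f n = gexpz x n * y.
Proof.
move=> f0 fS; elim/int_rect => [|n IH|n IH].
- by rewrite f0 /= mul1g.
- have -> : Posz n.+1 = (Posz n + 1)%R by lia.
  by rewrite fS gexpzS IH mulgA.
- apply: (mulgI x); rewrite -fS mulgA -gexpzS.
  by have -> : (- Posz n.+1 + 1 = - Posz n)%R by lia.
Qed.

Lemma gexpz_intertwine {G : groupType} {x x' y : G} :
  y * x = x' * y -> forall n, y * gexpz x n = gexpz x' n * y.
Proof.
move=> yx; apply: gexpz_unique => [|n]; first by rewrite /= mulg1.
by rewrite gexpzS mulgA yx -mulgA.
Qed.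

Lemma gexpzD {G : groupType} (x : G) (m n : int) :
  gexpz x (m + n)%R = gexpz x m * gexpz x n.
Proof.
move: m; apply: gexpz_unique => [|m]; first by rewrite add0r.
by rewrite addrAC gexpzS.
Qed.

Lemma gexpVz {G : groupType} (x : G) (n : int) :
  gexpz x^-1 n = gexpz x (- n)%R.
Proof.
rewrite -[LHS]mulg1; move: n; apply: fsym; apply: gexpz_unique => // n.
apply: (mulgI x); rewrite mulVKg -gexpzS.
by congr gexpz; lia.
Qed.

Lemma gexpzMl {G : groupType} (x y : G) (n : int) :
  commute x y -> gexpz (x * y) n = gexpz x n * gexpz y n.
Proof.
move=> xy; rewrite -[LHS]mulg1; move: n; apply: fsym.
apply: gexpz_unique => [|n]; first by rewrite /= mulg1.
rewrite !gexpzS -!mulgA; congr (_ * _); rewrite !mulgA; congr (_ * _).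
by rewrite (gexpz_intertwine (esym xy)).
Qed.

Lemma gexpz_morph {G H : groupType} (f : UMagmaMorphism.type G H) x n :
  f (gexpz x n) = gexpz (f x) n.
Proof. by case: n => n /=; rewrite ?gmulfXVn ?gmulfXn. Qed.

Lemma gexpz_closed {G : groupType} (H : {pred G}) (x : G) (n : int) :
  group_closed H -> x \in H -> gexpz x n \in H.
Proof.
move=> Hc xH.
have Xn k : x ^+ k \in H.
  elim: k => [|k IH]; first by case: Hc.
  by rewrite expgS; apply: (group_closedM Hc).
by case: n => n; [exact: Xn|exact: (group_closedV Hc)].
Qed.

End IntegerPowers.

(** * Normal forms in a Heisenberg group extended by an involution *)

Section NormalForm.
Local Open Scope group_scope.

Definition heis_relations {G : groupType} (a b t r : G) :=
  [/\ commute t a, commute t b, commute t r & b * a = t * a * b]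
  /\ [/\ r * r = 1, r * a = a^-1 * t * r & r * b = b^-1 * r].

Definition nform {G : groupType} (a b t r : G) (m n k : int) (e : bool) :=
  gexpz a m * gexpz b n * gexpz t k * r ^+ e.

Definition has_nform {G : groupType} (a b t r x : G) :=
  exists m n k e, x = nform a b t r m n k e.

Lemma nform_morph {G H : groupType} (f : UMagmaMorphism.type G H)
    (a b t r : G) m n k e :
  f (nform a b t r m n k e) = nform (f a) (f b) (f t) (f r) m n k e.
Proof. by rewrite /nform !gmulfM gmulfXn !gexpz_morph. Qed.

Context {G : groupType} {a b t r : G}.
Hypothesis rels : heis_relations a b t r.
Local Notation nf := (nform a b t r).

Let ta : t * a = a * t. Proof. by case: rels => -[]. Qed.
Let tb : t * b = b * t. Proof. by case: rels => -[]. Qed.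
Let tr : t * r = r * t. Proof. by case: rels => -[]. Qed.
Let ba : b * a = t * a * b. Proof. by case: rels => -[]. Qed.
Let rr : r * r = 1. Proof. by case: rels => _ []. Qed.
Let ra : r * a = a^-1 * t * r. Proof. by case: rels => _ []. Qed.
Let rb : r * b = b^-1 * r. Proof. by case: rels => _ []. Qed.

Let tza n : gexpz t n * a = a * gexpz t n.
Proof. exact/esym/gexpz_intertwine/esym. Qed.
Let tzb n : gexpz t n * b = b * gexpz t n.
Proof. exact/esym/gexpz_intertwine/esym. Qed.
Let tzr n : gexpz t n * r = r * gexpz t n.
Proof. exact/esym/gexpz_intertwine/esym. Qed.

Lemma nform1 : nf 0%R 0%R 0%R false = 1.
Proof. by rewrite /nform /= !mulg1. Qed.

Lemma mul_a_nform m n k e : a * nf m n k e = nf (m + 1)%R n k e.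
Proof. by rewrite /nform gexpzS !mulgA. Qed.

Lemma mul_t_nform m n k e : t * nf m n k e = nf m n (k + 1)%R e.
Proof.
rewrite /nform gexpzS !mulgA (gexpz_intertwine ta).
by rewrite -[_ * t * _]mulgA (gexpz_intertwine tb) !mulgA.
Qed.

(** Moving b to the right past a^m costs the central factor t^m. *)
Lemma mul_b_nform m n k e : b * nf m n k e = nf m (n + 1)%R (k + m)%R e.
Proof.
rewrite /nform gexpzS [(k + m)%R]addrC gexpzD !mulgA.
rewrite (gexpz_intertwine ba) gexpzMl //.
rewrite (gexpz_intertwine (tza m)) -!mulgA; congr (_ * _).
by rewrite !mulgA tzb -[_ * _ * gexpz b n]mulgA (gexpz_intertwine (tzb m)) !mulgA.
Qed.

(** Conjugation by r sends a^m to (a^-1 t)^m = a^-m t^m, whence the shift of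
    the central exponent. *)
Lemma mul_r_nform m n k e :
  r * nf m n k e = nf (- m)%R (- n)%R (k + m)%R (~~ e).
Proof.
rewrite /nform !mulgA (gexpz_intertwine ra).
rewrite gexpzMl; last exact/commute_sym/commuteV.
rewrite !gexpVz addrC gexpzD -!mulgA; congr (_ * _).
rewrite [r * _]mulgA (gexpz_intertwine rb) gexpVz.
rewrite !mulgA (gexpz_intertwine (tzb m)) -!mulgA; congr (_ * (_ * _)).
rewrite mulgA -tzr -mulgA; congr (_ * _).
by case: e => /=; rewrite ?mulg1.
Qed.

Lemma has_nform_mul x :
  has_nform a b t r x ->
  [/\ has_nform a b t r (a * x), has_nform a b t r (b * x),
     has_nform a b t r (r * x), has_nform a b t r (t * x)
   & has_nform a b t r (t^-1 * x)].
Proof.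
case=> m [n [k [e ->]]].
rewrite mul_a_nform mul_b_nform mul_r_nform mul_t_nform.
split; try by do 4 eexists.
exists m, n, (k - 1)%R, e.
by apply: (mulgI t); rewrite mulVKg mul_t_nform subrK.
Qed.

End NormalForm.

(** * The relations of the stabiliser *)

Section Generators.
Local Open Scope group_scope.

Definition cusp_relations {G : groupType} (r1 r2 r3 t : G) :=
  [/\ r1 * r1 = 1, r3 * r3 = 1, commute t r1, commute t r3 & t = r2 * r2]
  /\ (r1 * r3 * r2) * (r1 * r3 * r2) = 1.

Lemma cusp_relations_morph {G H : groupType} (f : UMagmaMorphism.type G H)
    {r1 r2 r3 t : G} :
  cusp_relations r1 r2 r3 t -> cusp_relations (f r1) (f r2) (f r3) (f t).
Proof.
case=> -[r1r1 r3r3 tr1 tr3 tE] rel; split; first split.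
- by rewrite -gmulfM r1r1 gmulf1.
- by rewrite -gmulfM r3r3 gmulf1.
- exact: gmulf_commute.
- exact: gmulf_commute.
- by rewrite -gmulfM -tE.
- by rewrite -!gmulfM rel gmulf1.
Qed.

Lemma cusp_relations_inj {G H : groupType} (f : UMagmaMorphism.type G H)
    {r1 r2 r3 t : G} : injective f ->
  cusp_relations (f r1) (f r2) (f r3) (f t) -> cusp_relations r1 r2 r3 t.
Proof.
move=> f_inj [[r1r1 r3r3 tr1 tr3 tE] rel].
by split; first split; apply: f_inj; rewrite ?gmulf1 ?gmulfM.
Qed.

(** Since t = r2^2 commutes with r2, it is central.  For an
    involution x, the product x r1 is inverted under conjugation by r1; for
    r2, whose square is t rather than 1, a correction by t appears.  With a = r2 r1 and b = r3 r1
    the last relation reads (b^-1 a r1)^2 = 1, and eliminating r1 turns it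
    into the commutation rule of a and b. *)
Lemma cusp_heis_relations {G : groupType} {r1 r2 r3 t : G} :
  cusp_relations r1 r2 r3 t -> heis_relations (r2 * r1) (r3 * r1) t r1.
Proof.
case=> -[r1r1 r3r3 tr1 tr3 tE].
have tr2 : commute t r2 by rewrite /commute tE mulgA.
have r1V : r1^-1 = r1 by apply: mulg1_eq.
have r3V : r3^-1 = r3 by apply: mulg1_eq.
have aE : r2 = r2 * r1 * r1 by rewrite -mulgA r1r1 mulg1.
have bE : r1 * r3 = (r3 * r1)^-1 by rewrite invgM r1V r3V.
have r1a : r1 * (r2 * r1) = (r2 * r1)^-1 * t * r1.
  by rewrite invgM r1V tE !mulgA mulgVK.
have r1b : r1 * (r3 * r1) = (r3 * r1)^-1 * r1 by rewrite invgM r1V r3V mulgA.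
have ta : commute t (r2 * r1) by apply: commuteM.
have tb : commute t (r3 * r1) by apply: commuteM.
rewrite bE {1 2}aE; move: (r2 * r1) (r3 * r1) r1a r1b ta tb => a b r1a r1b ta tb.
(* From here on a and b are atoms, related to r1 by r1a and r1b only. *)
have r1bV : r1 * b^-1 = b * r1.
  by apply: (mulIg b); rewrite mulgVK -mulgA r1b mulVKg.
rewrite -!mulgA [r1 * (b^-1 * _)]mulgA r1bV -(mulgA b) [r1 * (a * _)]mulgA r1a.
(* The relation has become b = a b a^-1 t. *)
rewrite -!mulgA r1r1 mulg1 => /mulg1_eq; rewrite invgK => {}bE.
do 2!split=> //; rewrite {1}bE -!mulgA [t * a]ta mulKg -[b * t]tb.
by rewrite !mulgA -ta.
Qed.

End Generators.

(** * Morphisms out of a presented group *)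

Section VonDyck.
Local Open Scope group_scope.

Definition eval_word {G : groupType} {I : choiceType} (g : I -> G)
    (w : word I) : G :=
  \prod_(l <- w) if l.2 then g l.1 else (g l.1)^-1.

Lemma eval_word_free_eq {G : groupType} {I : choiceType} (g : I -> G) u v :
  free_eq u v -> eval_word g u = eval_word g v.
Proof.
rewrite /eval_word; elim=> {u v} [u i b v|u|u v _ ->|v u w _ -> _ ->] //.
rewrite !big_cat !big_cons /=; congr (_ * _).
by case: b; rewrite /= ?mulVKg ?mulKg.
Qed.

Definition free_eval {G : groupType} {I : choiceType} (g : I -> G)
  (x : free_group I) : G := eval_word g (free_repr x).

Lemma free_evalE {G : groupType} {I : choiceType} (g : I -> G) (w : word I) :
  free_eval g (free_class w) = eval_word g w.
Proof. exact/esym/eval_word_free_eq/repr_free. Qed.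

Lemma free_evalM {G : groupType} {I : choiceType} (g : I -> G) :
  {morph free_eval g : x y / x * y}.
Proof.
elim/freeW=> u; elim/freeW=> v; rewrite [_ * _]free_mulE !free_evalE.
by rewrite /eval_word big_cat.
Qed.

Lemma free_eval1 {G : groupType} {I : choiceType} (g : I -> G) :
  free_eval g 1 = 1.
Proof. by rewrite [1]/(free_class _) free_evalE /eval_word big_nil. Qed.

HB.instance Definition _ (G : groupType) (I : choiceType) (g : I -> G) :=
  isUMagmaMorphism.Build (free_group I) G (free_eval g)
    (free_eval1 g, free_evalM g).

Lemma free_eval_gen {G : groupType} {I : choiceType} (g : I -> G) i :
  free_eval g (free_gen i) = g i.
Proof. by rewrite free_evalE /eval_word big_seq1. Qed.

HB.instance Definition _ (G : groupType) (N : normalSubgroup G) :=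
  isUMagmaMorphism.Build G (quotg N) (quotg_proj N) (erefl, quotg_projM N).

Section Kernel.
Context {G H : groupType} (f : UMagmaMorphism.type G H).

Definition kernel_pred : {pred G} := fun x => f x == 1.

Lemma kernel_closed : group_closed kernel_pred.
Proof.
split=> [|x y /eqP fx /eqP fy]; apply/eqP; first exact: gmulf1.
by rewrite gmulfF fx fy divgg.
Qed.

Lemma kernel_conj x y : x \in kernel_pred -> x ^ y \in kernel_pred.
Proof.
by move=> /eqP fx; apply/eqP; rewrite conjgE !gmulfM fx mul1g -gmulfM mulVg gmulf1.
Qed.

Definition kernel : normalSubgroup G := NormalSubgroup kernel_closed kernel_conj.

End Kernel.

Section Presented.
Context {I : choiceType} {rels : seq (free_group I)}.

Local Notation proj := (quotg_proj (normal_closure [pred r in rels])).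

(** The projection onto the presented group is itself an evaluation, so that
    results about [free_eval] for arbitrary generators apply to it. *)
Lemma free_eval_presented_gen (x : free_group I) :
  free_eval (presented_gen rels) x = proj x :> presented_group rels.
Proof.
move: x; apply: freeW; elim=> [|[i b] w IH]; first by rewrite gmulf1.
have -> : free_class ((i, b) :: w)
    = (if b then free_gen i else (free_gen i)^-1) * free_class w.
  by case: b; rewrite ?[(free_gen i)^-1]free_invE [RHS]free_mulE.
rewrite !gmulfM /= IH; congr (_ * _).
by case: b; rewrite ?gmulfV /= free_eval_gen.
Qed.

Lemma presented_gen_relator r :
  r \in rels -> free_eval (presented_gen rels) r = 1.
Proof.
move=> rr; rewrite free_eval_presented_gen; apply/esym/quotg_eqP.
by rewrite invg1 mul1g; apply/asboolP => N; apply.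
Qed.

Context {G : groupType} (g : I -> G).
Hypothesis g_rels : forall r, r \in rels -> free_eval g r = 1.

Definition presented_eval (x : presented_group rels) : G :=
  free_eval g (quotg_repr x).

(** Independence of the representative: the kernel of the evaluation is a
    normal subgroup containing the relators, hence their normal closure. *)
Lemma presented_evalE x : presented_eval (proj x) = free_eval g x.
Proof.
have ker r : r \in rels -> r \in kernel (free_eval g).
  by move=> /g_rels gr; apply/eqP.
have /asboolP/(_ _ ker)/eqP := repr_quotg (normal_closure [pred r in rels]) x.
by rewrite gmulfM gmulfV => /mulg1_eq; rewrite invgK.
Qed.

Lemma presented_evalM : {morph presented_eval : x y / x * y}.
Proof.
by elim/quotgW=> x; elim/quotgW=> y; rewrite -quotg_projM !presented_evalE gmulfM.
Qed.

Lemma presented_eval1 : presented_eval 1 = 1.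
Proof. by apply: (mulgI (presented_eval 1)); rewrite -presented_evalM !mulg1. Qed.

HB.instance Definition _ :=
  isUMagmaMorphism.Build (presented_group rels) G presented_eval
    (presented_eval1, presented_evalM).

(** Bundled because the morphism property depends on the hypothesis on the
    relators, which cannot be inferred from the function alone. *)
Definition presented_morphism : UMagmaMorphism.type (presented_group rels) G :=
  presented_eval.

Lemma presented_morphism_gen i : presented_morphism (presented_gen rels i) = g i.
Proof. by rewrite /= presented_evalE free_eval_gen. Qed.

Lemma bijective_has_presentation :
  (forall x, presented_morphism x = 1 -> x = 1) ->
  (forall y, exists x, presented_morphism x = y) -> has_presentation g rels.
Proof.
move=> inj surj; exists presented_morphism; split=> [|| i].
- exact: gmulfM.
- have y_pre y := cid (surj y).
  exists (fun y => sval (y_pre y)) => [x|y]; last exact: (svalP (y_pre y)).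
  exact: (gmulf_inj inj (svalP (y_pre _))).
- exact: presented_morphism_gen.
Qed.

End Presented.

End VonDyck.

(** * A criterion for the presentation *)

Section CuspPresentation.
Local Open Scope group_scope.

(* The scope on the indices matters: in group scope, 1 would be the identity
   of the additive group of ordinals, that is, the index 0. *)
Local Notation nformg g :=
  (nform (g 1%R * g 0%R) (g 2%R * g 0%R) (g 3%R) (g 0%R)).
Local Notation has_nformg g :=
  (has_nform (g 1%R * g 0%R) (g 2%R * g 0%R) (g 3%R) (g 0%R)).

Lemma cusp_relatorsP {G : groupType} (g : 'I_4 -> G) :
  (forall r, r \in Gamma7_inf_relators -> free_eval g r = 1) <->
  cusp_relations (g 0%R) (g 1%R) (g 2%R) (g 3%R).
Proof.
have commutator_eq1 (x y : G) : commutator x y = 1 <-> commute x y.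
  split=> [/divg1_eq xy|xy]; first by apply: (mulIg x^-1); rewrite xy mulgK.
  by rewrite /commutator xy !mulgK mulgV.
split=> [rel|[[r1r1 r3r3 tr1 tr3 tE] rel] r].
  have {rel} : all (fun r => free_eval g r == 1) Gamma7_inf_relators.
    by apply/allP => r /rel ->.
  rewrite /= /commutator !(gmulfXVn, gmulfXn, gmulfM, gmulfV) /= !free_eval_gen.
  case/and5P=> /eqP r1r1 /eqP r3r3 /eqP/commutator_eq1 tr1 /eqP/commutator_eq1 tr3.
  by case/and3P=> /eqP/divg1_eq tE /eqP rel _.
move=> r_rel; apply/eqP; move: r r_rel; apply/allP.
rewrite /= /commutator !(gmulfXVn, gmulfXn, gmulfM, gmulfV) /= !free_eval_gen.
rewrite -!/(commutator _ _) !(commutator_eq1 _ _).2 // !expg2 r1r1 r3r3 rel.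
by rewrite -tE mulgV eqxx.
Qed.

(** Each letter is a product of a, b, r, t and t^-1: with r the first
    generator, r2 = a r, r3 = b r, and r2^-1 = t^-1 r2. *)
Lemma cusp_word_nform {G : groupType} (g : 'I_4 -> G) (w : word 'I_4) :
  cusp_relations (g 0%R) (g 1%R) (g 2%R) (g 3%R) ->
  has_nformg g (eval_word g w).
Proof.
move=> rels; have nf_mul := has_nform_mul (cusp_heis_relations rels).
case: rels => -[r1r1 r3r3 tr1 tr3 tE] _.
have r1V : (g 0%R)^-1 = g 0%R by apply: mulg1_eq.
have r3V : (g 2%R)^-1 = g 2%R by apply: mulg1_eq.
have r2V : (g 1%R)^-1 = (g 3%R)^-1 * g 1%R by rewrite tE invgM mulgVK.
rewrite /eval_word; elim: w => [|[i b] w IH].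
  by rewrite big_nil -(nform1 (a := g 1%R * g 0%R) (b := g 2%R * g 0%R)
    (t := g 3%R) (r := g 0%R)); do 4 eexists.
rewrite big_cons /=; move: (\prod_(l <- w) _) IH => x xnf.
have [_ _ r1x tx tVx] := nf_mul _ xnf.
have [] := nf_mul _ r1x; rewrite -!mulgA !(mulgA (g 0%R) (g 0%R)) r1r1 !mul1g.
move=> r2x r3x _ _ _; have [_ _ _ _ r2Vx] := nf_mul _ r2x.
case: i => -[|[|[|[|//]]]] lt_i.
- rewrite (_ : Ordinal lt_i = 0%R); last exact: val_inj.
  by case: b; rewrite ?r1V.
- rewrite (_ : Ordinal lt_i = 1%R); last exact: val_inj.
  by case: b; rewrite // r2V -mulgA.
- rewrite (_ : Ordinal lt_i = 2%R); last exact: val_inj.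
  by case: b; rewrite ?r3V.
- rewrite (_ : Ordinal lt_i = 3%R); last exact: val_inj.
  by case: b.
Qed.

(** Only the class of 1 has to be inspected for uniqueness: an element of the
    kernel is a normal form, and its image is the normal form with the same
    exponents. *)
Lemma cusp_presentation {G : groupType} (g : 'I_4 -> G) :
  cusp_relations (g 0%R) (g 1%R) (g 2%R) (g 3%R) ->
  (forall x, has_nformg g x) ->
  (forall m n k e,
    nformg g m n k e = 1 ->
    [/\ m = 0%R, n = 0%R, k = 0%R & e = false]) ->
  generates g /\ has_presentation g Gamma7_inf_relators.
Proof.
move=> rels nf_all nf_triv; split=> [H Hc gH x|].
  have [m [n [k [e ->]]]] := nf_all x.
  have HM := group_closedM Hc.
  have e_closed : g 0%R ^+ e \in H.
    by case: e => /=; [exact: gH | case: Hc].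
  by rewrite /nform !HM ?gexpz_closed ?HM.
have g_rels : forall r, r \in Gamma7_inf_relators -> free_eval g r = 1.
  exact/cusp_relatorsP.
pose p := presented_gen Gamma7_inf_relators.
have p_rels : cusp_relations (p 0%R) (p 1%R) (p 2%R) (p 3%R).
  exact/cusp_relatorsP/presented_gen_relator.
pose f := presented_morphism g g_rels.
have eval_nf m n k e : f (nformg p m n k e) = nformg g m n k e.
  by rewrite nform_morph !gmulfM !presented_morphism_gen.
apply: (bijective_has_presentation g g_rels); last first.
  move=> y; have [m [n [k [e ->]]]] := nf_all y.
  by exists (nformg p m n k e); exact: eval_nf.
elim/quotgW; elim/freeW=> w; rewrite -free_eval_presented_gen free_evalE.
have [m [n [k [e ->]]]] := cusp_word_nform p w p_rels.
by rewrite eval_nf => /nf_triv[-> -> -> ->]; rewrite nform1.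
Qed.

End CuspPresentation.

(** * The ring O_7 *)

Section RingO7.
Variable C : numClosedFieldType.
Local Open Scope ring_scope.
Local Notation w := (omega7 C).

Lemma O7P (x : C) :
  reflect (exists m n : int, x = m%:~R + n%:~R * w) (x \in @O7 C).
Proof.
apply: (iffP (asboolP _)) => [[p ->]|[m [n ->]]]; last first.
  exists (m%:P + n%:P * 'X).
  by rewrite rmorphD rmorphM /= !map_polyC map_polyX !hornerE.
(* [omega7] is made opaque since rewriting would otherwise unfold it. *)
move: w (omega7_sq C) => v v_sq; elim/poly_ind: p => [|p c [m [n IH]]].
  by exists 0, 0; rewrite rmorph0 horner0 mul0r addr0.
exists (c - 2 * n), (m + n).
rewrite rmorphD rmorphM /= map_polyX map_polyC !hornerE IH.
rewrite intrB intrM !intrD.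
by ring: v_sq.
Qed.

Lemma i_sqrt7E : i_sqrt7 C = 2 * w - 1.
Proof. by rewrite /omega7; field. Qed.

Lemma i_sqrt7_neq0 : i_sqrt7 C != 0.
Proof. by rewrite -sqrf_eq0 i_sqrt7_sq oppr_eq0 pnatr_eq0. Qed.

(** The imaginary part of m + n w is n sqrt 7 / 2. *)
Lemma omega7_free (m n : int) : m%:~R + n%:~R * w = 0 -> m = 0 /\ n = 0.
Proof.
move: w (conj_omega7 C) i_sqrt7E => v v_conj sE mn0.
have := congr1 Num.conj mn0.
rewrite rmorphD rmorphM /= !rmorph_int rmorph0 v_conj => mn0'.
have : n%:~R * i_sqrt7 C = 0.
  by rewrite sE -[RHS](subrr 0) -{1}mn0 -mn0'; ring.
move/eqP; rewrite mulf_eq0 (negPf i_sqrt7_neq0) orbF intr_eq0 => /eqP n0.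
by move: mn0; rewrite n0 mul0r addr0 => /eqP; rewrite intr_eq0 => /eqP.
Qed.

Lemma norm_omega7 (m n : int) :
  (m%:~R + n%:~R * w) * (m%:~R + n%:~R * w)^* = (m ^+ 2 + m * n + 2 * n ^+ 2)%:~R.
Proof.
move: w (omega7_sq C) (conj_omega7 C) => v v_sq v_conj.
rewrite rmorphD rmorphM /= !rmorph_int v_conj !intrD !intrM.
by ring: v_sq.
Qed.

(** The norm of m + n w is m^2 + m n + 2 n^2, and 4 times it is
    (2 m + n)^2 + 7 n^2; so norm 1 forces n = 0 and m = 1 or -1. *)
Lemma O7_unit (x y : C) : x \in @O7 C -> y \in @O7 C -> x * y^* = 1 ->
  exists b : bool, x = (-1) ^+ b /\ y = (-1) ^+ b.
Proof.
move=> /O7P[m [n xE]] /O7P[p [q yE]] xy.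
have : (x * y^*) * (x * y^*)^* = 1 by rewrite xy rmorph1 mulr1.
have -> : x * y^* * (x * y^*)^* = (x * x^*) * (y * y^*).
  by rewrite rmorphM /= conjCK; ring.
rewrite {1 2}xE {1 2}yE !norm_omega7 -intrM => /(intr_inj (R := C) (x2 := 1)) N1.
have norm_ge0 (i j : int) : 0 <= i ^+ 2 + i * j + 2 * j ^+ 2.
  by nia.
have Nm : m ^+ 2 + m * n + 2 * n ^+ 2 = 1.
  move: N1 (norm_ge0 m n) (norm_ge0 p q).
  move: (m ^+ 2 + m * n + 2 * n ^+ 2) (p ^+ 2 + p * q + 2 * q ^+ 2).
  move=> X Y XY X0 Y0.
  have X1 : 1 <= X by nia.
  have Y1 : 1 <= Y by nia.
  by nia.
have n0 : n = 0 by nia.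
have m1 : m = 1 \/ m = -1 by move: Nm; rewrite n0; nia.
have x_sign : exists b : bool, x = (-1) ^+ b.
  case: m1 => m1; rewrite xE n0 m1 mul0r addr0.
    by exists false.
  by exists true.
case: x_sign => b xb; exists b; split=> //.
move: xy; rewrite xb => /(congr1 (fun z => ((-1) ^+ b * z)^*)).
by rewrite mulrA -signr_addb addbb mul1r conjCK mulr1 rmorph_sign.
Qed.

End RingO7.

Arguments O7_unit {C x y}.

(** * Upper triangular matrices and the generators *)

Section HeisenbergMatrices.
Variable C : numClosedFieldType.
Local Open Scope ring_scope.
Local Notation w := (omega7 C).

(** The shape, up to a scalar, of a matrix of U(2,1) that fixes q_infty and
    has signs on the diagonal.  The entry in row 0, column 1 is forced by
    orthogonality of the last two columns. *)
Definition heis_mx (e : bool) (d s : C) : 'M[C]_3 :=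
  mx3 [:: [:: 1; - ((-1) ^+ e * d^*); s];
          [:: 0; (-1) ^+ e; d];
          [:: 0; 0; 1]].

Lemma heis_mx_mul e d s e' d' s' :
  heis_mx e d s *m heis_mx e' d' s' =
  heis_mx (e (+) e') (d + (-1) ^+ e * d') (s + s' - (-1) ^+ e * d^* * d').
Proof.
apply/matrixP => i j; rewrite !mxE !big_ord_recl big_ord0 !mxE.
rewrite rmorphD rmorphM rmorph_sign signr_addb.
by case: i j => -[|[|[|//]]] ? [[|[|[|//]]] ?];
  case: e; case: e'; rewrite /=; ring.
Qed.

Lemma heis_mx1 : heis_mx false 0 0 = 1%:M.
Proof.
apply/matrixP => i j; rewrite !mxE.
by case: i j => -[|[|[|//]]] ? [[|[|[|//]]] ?]; rewrite /= ?rmorph0 ?mulr0 ?oppr0.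
Qed.

(** A version of [gexpz_unique] for explicit matrices, whose membership in
    U(2,1) comes out as a consequence. *)
Lemma U21_gexpz_mx (x : U21 C) (F : int -> 'M[C]_3) :
  F 0 = 1%:M -> (forall n, F (n + 1) = (x : 'M_3) *m F n) ->
  forall n, (gexpz x n : 'M_3) = F n.
Proof.
move=> F0 FS; elim/int_rect => [|n IH|n IH]; first by rewrite F0.
- have -> : Posz n.+1 = (Posz n + 1) by lia.
  by rewrite gexpzS FS -IH.
- apply: (can_inj (mulKmx (U21_unit x))); rewrite -FS.
  have -> : - Posz n.+1 + 1 = - Posz n by lia.
  rewrite -IH; have -> : - Posz n = - Posz n.+1 + 1 by lia.
  by rewrite gexpzS.
Qed.

(** In the product of x^i and x the corners add up to within the cocycle
    - i d^* d; summed over i < n this gives the binomial coefficient. *)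
Lemma gexpz_heis_mx (x : U21 C) (d s : C) (n : int) :
  (x : 'M_3) = heis_mx false d s ->
  (gexpz x n : 'M_3) =
  heis_mx false (n%:~R * d) (n%:~R * s - n%:~R * (n%:~R - 1) / 2 * (d^* * d)).
Proof.
move=> xE; move: n; apply: U21_gexpz_mx => [|n].
  by rewrite -heis_mx1 !mul0r subr0.
rewrite xE heis_mx_mul /= intrD.
by congr heis_mx; field.
Qed.

(** The relations already hold for these matrices, before passing to classes
    modulo scalars, so computations can be done in U(2,1). *)
Definition U21_gens : 'I_4 -> U21 C :=
  tnth [tuple MkU21 (R1_herm21 C); MkU21 (R2_herm21 C);
              MkU21 (R3_herm21 C); MkU21 (T_herm21 C)].

Lemma U21_gens_heis_mx :
  [/\ (U21_gens 0 : 'M_3) = heis_mx true 0 0,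
      (U21_gens 1 : 'M_3) = heis_mx true 1 (- w^*),
      (U21_gens 2 : 'M_3) = heis_mx true w (-1)
    & (U21_gens 3 : 'M_3) = heis_mx false 0 (i_sqrt7 C)].
Proof.
by split; rewrite /heis_mx /= ?rmorph0 ?rmorph1 ?mulr0 ?oppr0 ?mulr1 ?mulN1r
  ?opprK.
Qed.

Lemma U21_gens_relations :
  cusp_relations (U21_gens 0) (U21_gens 1) (U21_gens 2) (U21_gens 3).
Proof.
have [E1 E2 E3 ET] := U21_gens_heis_mx.
rewrite i_sqrt7E in ET; move: E1 E2 E3 ET.
move: (U21_gens 0) (U21_gens 1) (U21_gens 2) (U21_gens 3) => r1 r2 r3 t.
move: w (omega7_sq C) (conj_omega7 C) => v v_sq v_conj.
rewrite v_conj => E1 E2 E3 ET.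
split; first split; rewrite /commute; apply: val_inj;
  rewrite /= ?E1 ?E2 ?E3 ?ET !heis_mx_mul -?heis_mx1 /=.
all: rewrite ?(rmorphD, rmorphN, rmorphM, rmorphXn, rmorph0, rmorph1) /= ?v_conj.
all: by congr heis_mx; ring: v_sq.
Qed.

(** The corner of A^m B^n. *)
Definition nform_height (m n : int) : C :=
  - (m%:~R * (m%:~R + 1) / 2 + n%:~R ^+ 2) + (m%:~R - m%:~R * n%:~R) * w.

Lemma nform_heis_mx m n k e :
  (nform (U21_gens 1%R * U21_gens 0%R)%g (U21_gens 2%R * U21_gens 0%R)%g
    (U21_gens 3) (U21_gens 0) m n k e : 'M_3) =
  heis_mx e (m%:~R + n%:~R * w) (nform_height m n + k%:~R * i_sqrt7 C).
Proof.
have [] := U21_gens_heis_mx.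
move: (U21_gens 0) (U21_gens 1) (U21_gens 2) (U21_gens 3) => r1 r2 r3 t E1 E2 E3 ET.
have aE : ((r2 * r1)%g : 'M_3) = heis_mx false 1 (- w^*).
  by rewrite /= E1 E2 heis_mx_mul; congr heis_mx; rewrite ?mulr0 ?addr0 ?subr0.
have bE : ((r3 * r1)%g : 'M_3) = heis_mx false w (-1).
  by rewrite /= E1 E3 heis_mx_mul; congr heis_mx; rewrite ?mulr0 ?addr0 ?subr0.
have eE : ((r1 ^+ e)%g : 'M_3) = heis_mx e 0 0.
  by case: e; rewrite ?heis_mx1.
have mulE (x y : U21 C) : ((x * y)%g : 'M_3) = (x : 'M_3) *m (y : 'M_3) by [].
rewrite /nform !mulE eE.
rewrite (gexpz_heis_mx _ _ _ _ aE) (gexpz_heis_mx _ _ _ _ bE).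
rewrite (gexpz_heis_mx _ _ _ _ ET).
rewrite !heis_mx_mul /nform_height /=.
move: w (omega7_sq C) (conj_omega7 C) => v v_sq v_conj.
rewrite !(rmorphD, rmorphM, rmorph0, rmorph1) /= !rmorph_int v_conj.
by congr heis_mx; field: v_sq.
Qed.

End HeisenbergMatrices.

Arguments heis_mx {C}.

(** * The stabiliser of q_infty *)

Section Stabiliser.
Variable C : numClosedFieldType.
Local Open Scope ring_scope.
Local Notation w := (omega7 C).
Local Notation gU := (U21_gens C).
Local Notation gG := (@Gamma7_inf_gens C).
Local Notation nformg g :=
  (nform (g 1%R * g 0%R)%g (g 2%R * g 0%R)%g (g 3) (g 0)).

Lemma U21_columns (A : U21 C) (i j : 'I_3) :
  A 0 i * (A 2 j)^* + A 1 i * (A 1 j)^* + A 2 i * (A 0 j)^* =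
  herm21 (delta_mx i 0) (delta_mx j 0 : 'cV[C]_3).
Proof. by rewrite -(U21P A) -!colE /herm21 !mxE. Qed.

Lemma U21_stab_q_infty (A : U21 C) :
  same_point (A *m q_infty C) (q_infty C) ->
  [/\ A 1 0 = 0, A 2 0 = 0 & A 2 1 = 0] /\
  [/\ A 0 0 * (A 2 2)^* = 1, A 1 1 * (A 1 1)^* = 1,
      A 0 1 * (A 2 2)^* + A 1 1 * (A 1 2)^* = 0
    & A 0 2 * (A 2 2)^* + A 1 2 * (A 1 2)^* + A 2 2 * (A 0 2)^* = 0].
Proof.
case=> c c0 Aq.
have col0 i : A i 0 = c * q_infty C i 0.
  have := congr1 (fun M : 'cV_3 => M i 0) Aq; rewrite !mxE => <-.
  by rewrite !big_ord_recl big_ord0 !mxE /= mulr1 !mulr0 !addr0.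
have A10 : A 1 0 = 0 by rewrite col0 mxE /= mulr0.
have A20 : A 2 0 = 0 by rewrite col0 mxE /= mulr0.
have simp := (rmorph0, rmorph1, mul0r, mulr0, mulr1, add0r, addr0).
have H i j := U21_columns A i j.
have A02 : A 0 0 * (A 2 2)^* = 1.
  by have := H 0 2; rewrite A10 A20 /herm21 !mxE /= !simp.
have A00_neq0 : A 0 0 != 0.
  by apply: contra_eqT A02 => /negbNE/eqP ->; rewrite mul0r eq_sym oner_eq0.
have A21 : A 2 1 = 0.
  have := H 1 0; rewrite A10 A20 /herm21 !mxE /= !simp.
  by move=> /eqP; rewrite mulf_eq0 conjC_eq0 (negPf A00_neq0) orbF => /eqP.
split; split=> //.
- by have := H 1 1; rewrite A21 /herm21 !mxE /= !simp.
- by have := H 1 2; rewrite A21 /herm21 !mxE /= !simp.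
- by have := H 2 2; rewrite /herm21 !mxE /= !simp.
Qed.

Lemma stab_heis_mx (A : U21 C) :
  same_point (A *m q_infty C) (q_infty C) -> (forall i j, A i j \in @O7 C) ->
  exists (b e : bool) (d s : C),
    [/\ (A : 'M_3) = (-1) ^+ b *: heis_mx e d s, d \in @O7 C, s \in @O7 C
      & s + s^* = - (d * d^*)].
Proof.
move=> /U21_stab_q_infty[[A10 A20 A21] [A00 A11 A01 A02]] AO.
have [b [A00E A22E]] := O7_unit (AO _ _) (AO _ _) A00.
have [e [A11E _]] := O7_unit (AO _ _) (AO _ _) A11.
have sgnO x : x \in @O7 C -> (-1) ^+ b * x \in @O7 C.
  have [O1 OB OM] := O7_closed C => xO; apply: OM => //.
  by case: b {A00E A22E}; rewrite ?expr1 ?expr0 ?O7_rules.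
exists b, (b (+) e), ((-1) ^+ b * A 1 2), ((-1) ^+ b * A 0 2).
have bb : (-1) ^+ b * (-1) ^+ b = 1 :> C by rewrite -signr_addb addbb.
rewrite A22E A11E rmorph_sign in A01 A02.
split; rewrite ?sgnO //; last first.
  rewrite !rmorphM rmorph_sign mulrACA bb mul1r.
  by apply/eqP; rewrite -addr_eq0 -[X in _ == X]A02; apply/eqP; ring.
apply/matrixP => i j; rewrite !mxE signr_addb rmorphM rmorph_sign.
have A01E : A 0 1 = - ((-1) ^+ b * ((-1) ^+ e * (A 1 2)^*)).
  by rewrite -(addr0_eq A01) mulrN opprK mulrCA bb mulr1.
case: i j => -[|[|[|//]]] i_lt [[|[|[|//]]] j_lt] /=; rewrite ?mulr0 ?mulr1.
- by rewrite -A00E; congr (A _ _); exact: val_inj.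
- by transitivity (A 0 1);
    [congr (A _ _); exact: val_inj | rewrite A01E; ring: bb].
- by rewrite mulrA bb mul1r; congr (A _ _); exact: val_inj.
- by rewrite -[RHS]A10; congr (A _ _); exact: val_inj.
- by rewrite mulrA bb mul1r -A11E; congr (A _ _); exact: val_inj.
- by rewrite mulrA bb mul1r; congr (A _ _); exact: val_inj.
- by rewrite -[RHS]A20; congr (A _ _); exact: val_inj.
- by rewrite -[RHS]A21; congr (A _ _); exact: val_inj.
- by rewrite -A22E; congr (A _ _); exact: val_inj.
Qed.

(** The entry d gives m and n.  Both s and the corner of A^m B^n have real part
    - |d|^2 / 2, so their difference is purely imaginary in O_7, and hence an
    integral multiple of i sqrt 7. *)
Lemma heis_mx_nform e d s :
  d \in @O7 C -> s \in @O7 C -> s + s^* = - (d * d^*) ->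
  exists m n k, heis_mx e d s = nformg gU m n k e :> 'M_3.
Proof.
move=> /O7P[m [n dE]] /O7P[x [y sE]].
have norm_ss : s + s^* = (2 * x + y)%:~R.
  move: w (conj_omega7 C) sE => v v_conj ->.
  by rewrite rmorphD rmorphM /= !rmorph_int v_conj !(intrD, intrM); ring.
rewrite norm_ss dE norm_omega7 -rmorphN => /intr_inj xy.
have [t tE] : exists t : int, m * (m + 1) = 2 * t.
  have [q [->|->]] : exists q : int, m = 2 * q \/ m = 2 * q + 1.
  - by exists (m %/ 2)%Z; lia.
  - by exists (q * (2 * q + 1)); ring.
  - by exists ((2 * q + 1) * (q + 1)); ring.
(* The corner of A^m B^n is - t - n^2 + (m - m n) w, and i sqrt 7 = 2 w - 1:
   compare the coefficients of 1. *)
exists m, n, (- x - n ^+ 2 - t); rewrite nform_heis_mx; congr heis_mx.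
have yE : y = m - m * n + 2 * (- x - n ^+ 2 - t) by nia.
have tE' : m%:~R * (m%:~R + 1) = 2 * t%:~R :> C.
  by rewrite -[1]/(1%:~R) -intrD -intrM tE intrM.
rewrite sE yE /nform_height tE' i_sqrt7E !(intrD, intrM, intrN).
by move: w => v; field.
Qed.

Lemma Gamma7_inf_gensE i : Gamma7_inf_val (gG i) = to_PU21 (gU i).
Proof. by case: i => -[|[|[|[|//]]]] i_lt. Qed.

Lemma Gamma7_inf_nformE m n k e :
  Gamma7_inf_val (nformg gG m n k e) = to_PU21 (nformg gU m n k e).
Proof.
rewrite [LHS](nform_morph val) [RHS](nform_morph (quotg_proj (U1 C))).
rewrite !gmulfM; congr (nform (_ * _)%g (_ * _)%g _ _ _ _ _ _);
  exact: Gamma7_inf_gensE.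
Qed.

Lemma Gamma7_inf_has_nform (g : Gamma7_inf C) :
  has_nform (gG 1%R * gG 0%R)%g (gG 2%R * gG 0%R)%g (gG 3) (gG 0) g.
Proof.
case: g => g g_inf; have /andP[/asboolP[A Ag AO]] := g_inf.
rewrite -{1}Ag => /PU21_stabP/stab_heis_mx/(_ AO)[b [e [d [s [AE dO sO ds]]]]].
have [m [n [k heisE]]] := heis_mx_nform e _ _ dO sO ds.
exists m, n, k, e; apply: val_inj; rewrite [RHS]Gamma7_inf_nformE /= -Ag.
apply/quotg_eqP/asboolP; exists ((-1) ^+ b).
  by rewrite normrX normrN1 expr1n.
have NE : (nformg gU m n k e : 'M_3) = (-1) ^+ b *: (A : 'M_3).
  by rewrite AE heisE scalerA -signr_addb addbb scale1r.
transitivity (invmx A *m (nformg gU m n k e : 'M_3)); first by [].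
by rewrite NE -scalemxAr mulVmx ?U21_unit // scalemx1.
Qed.

(** A normal form in the class of the identity is a scalar matrix: its last
    column then reads off n, m and k, and its middle entry e. *)
Lemma Gamma7_inf_nform_eq1 m n k e :
  nformg gG m n k e = 1%g -> [/\ m = 0, n = 0, k = 0 & e = false].
Proof.
move=> /(congr1 (@Gamma7_inf_val C)); rewrite Gamma7_inf_nformE => /to_PU21_eq[c c0].
rewrite nform_heis_mx => E.
have {E} E i j := congr1 (fun M : 'M_3 => M i j) E.
(* The corner entry 1 at the lower right shows that the scalar is 1. *)
have c1 := E 2 2; have e1 := E 1 1; have d0 := E 1 2; have s0 := E 0 2.
rewrite !mxE /= ?mulr1 ?mulr0 in c1 e1 d0 s0.
have [m0 n0] := omega7_free C m n d0.
have e_false : e = false.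
  move: e1; rewrite -c1; case: (e) => // /eqP.
  by rewrite -subr_eq0 -opprD oppr_eq0 -mulr2n pnatr_eq0.
have k0 : k = 0.
  have h0 : nform_height C 0 0 = 0 by rewrite /nform_height; move: w => v; field.
  move: s0; rewrite m0 n0 h0 add0r => /eqP.
  by rewrite mulf_eq0 (negPf (i_sqrt7_neq0 C)) orbF intr_eq0 => /eqP.
by [].
Qed.

Lemma Gamma7_inf_gens_relations :
  cusp_relations (gG 0) (gG 1) (gG 2) (gG 3).
Proof.
apply: (cusp_relations_inj val val_inj).
exact: (cusp_relations_morph (quotg_proj (U1 C)) (U21_gens_relations C)).
Qed.

End Stabiliser.

Theorem proposition3p3 (R : realType) :
  generates (@Gamma7_inf_gens R[i]) /\
  has_presentation (@Gamma7_inf_gens R[i]) Gamma7_inf_relators.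
Proof.
apply: cusp_presentation; first exact: Gamma7_inf_gens_relations.
  exact: Gamma7_inf_has_nform.
exact: Gamma7_inf_nform_eq1.
Qed.
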